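(* Let $\psi\colon T\to S$ be a proper morphism between restriction semigroups, let $p=\psi|_{P(T)}\colon P(T)\to P(S)$, and let $\widehat{\psi},\widetilde{\psi}\colon S\to\mathcal{I}(P(T))$ be the upper and the lower underlying premorphisms of $\psi$. Then there is an isomorphism of restriction semigroups $$T\;\simeq\; P(T)\rtimes^{p}_{\widehat{\psi}} S,$$ and moreover $P(T)\rtimes^{p}_{\widehat{\psi}} S = P(T)\rtimes^{p}_{\widetilde{\psi}} S$ (equality of restriction semigroups).
   Context: A restriction semigroup is an algebra $(S;\cdot,{}^*,{}^+)$ of type $(2,1,1)$ such that $(S;\cdot)$ is a semigroup and the following identities hold: $x^+x=x$, $x^+y^+=y^+x^+$, $(x^+y)^+=x^+y^+$, $(xy)^+x=xy^+$; $xx^*=x$, $x^*y^*=y^*x^*$, $(xy^* )^*=x^*y^*$, $y(xy)^*=x^*y$; $(x^+)^*=x^+$, $(x^* )^+=x^*$. Morphisms preserve all three operations. $P(S)=\{s^*\colon s\in S\}=\{s^+\colon s\in S\}$ is the semilattice of projections of $S$ (under multiplication). The natural partial order is: $s\le t$ iff $s=et$ for some $e\in P(S)$ (equivalently $s=tf$ for some $f\in P(S)$). Elements $s,t$ are compatible, $s\sim t$, if $st^*=ts^*$ and $t^+s=s^+t$. A morphism $\psi\colon T\to S$ is proper if it is surjective and $\psi(u)=\psi(v)$ implies $u\sim v$ for all $u,v\in T$. $\mathcal{I}(X)$ is the symmetric inverse semigroup of all partial bijections of $X$, composed from right to left. For a proper morphism $\psi\colon T\to S$, the upper underlying premorphism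 $\widehat{\psi}\colon S\to\mathcal{I}(P(T))$, $s\mapsto\widehat\psi_s$, is given by $\operatorname{dom}\widehat\psi_s=\{e\in P(T)\colon e\le t^*\text{ for some }t\in T\text{ with }\psi(t)\le s\}$ and $\widehat\psi_s(e)=(te)^+$, where $t\in T$ is any element with $e\le t^*$ and $\psi(t)\le s$. The lower underlying premorphism $\widetilde{\psi}\colon S\to\mathcal{I}(P(T))$, $s\mapsto\widetilde\psi_s$, is given by $\operatorname{dom}\widetilde\psi_s=\{e\in P(T)\colon e\le t^*\text{ for some }t\in T\text{ with }\psi(t)= s\}$ and $\widetilde\psi_s(e)=(te)^+$, where $t\in T$ is any element with $e\le t^*$ and $\psi(t)=s$. (These are well-defined partial bijections.) Partial action product: given a semilattice $Y$, a semilattice morphism $q\colon Y\to P(S)$ and $\varphi\colon S\to\mathcal{I}(Y)$, $s\mapsto \varphi_s$ (here $(\varphi,q,Y)$ is $(\widehat\psi,p,P(T))$ or $(\widetilde\psi,p,P(T))$, for which all operations below are well defined and yield a restriction semigroup), $Y\rtimes^q_\varphi S$ is the set $\{(y,s)\in Y\times S\colon y\in\operatorname{ran}\varphi_s\text{ and }q(y)=s^+\}$ with multiplication $(y,s)(x,t)=(\varphi_s(\varphi_s^{-1}(y)\wedge x),st)$ and unary operations $(y,s)^*=(\varphi_s^{-1}(y),s^* )$, $(y,s)^+=(y,s^+)$. *)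

(* Defs.v *)
From HB Require Import structures.
From mathcomp Require Import all_boot.
From mathcomp Require Import boolp.
Import monoid.

Set Implicit Arguments.
Unset Strict Implicit.
Unset Printing Implicit Defensive.

Local Open Scope group_scope.

(* Restriction semigroups, with [rstar x] for x^* and [rplus x] for x^+.
   The carriers are arbitrary types: MathComp's [semigroupType] would in
   addition ask for a choice structure, so only its mixins are used. *)

HB.mixin Record hasStarPlus S := {
  rstar : S -> S;
  rplus : S -> S
}.

HB.structure Definition BiunaryMagma := {S of hasMul S & hasStarPlus S}.

HB.mixin Record BiunaryMagma_isRestriction S of BiunaryMagma S := {
  rmulA : associative (@mul S);
  rplusK : forall x : S, rplus x * x = x;
  rplusC : forall x y : S, rplus x * rplus y = rplus y * rplus x;
  rplus_mull : forall x y : S, rplus (rplus x * y) = rplus x * rplus y;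
  rplus_ample : forall x y : S, rplus (x * y) * x = x * rplus y;
  rstarK : forall x : S, x * rstar x = x;
  rstarC : forall x y : S, rstar x * rstar y = rstar y * rstar x;
  rstar_mulr : forall x y : S, rstar (x * rstar y) = rstar x * rstar y;
  rstar_ample : forall x y : S, y * rstar (x * y) = rstar x * y;
  rstar_plus : forall x : S, rstar (rplus x) = rplus x;
  rplus_star : forall x : S, rplus (rstar x) = rstar x
}.

#[short(type="restrictionType")]
HB.structure Definition Restriction :=
  {S of BiunaryMagma_isRestriction S & BiunaryMagma S}.

HB.mixin Record isStarPlusMorphism (T S : BiunaryMagma.type) (f : T -> S) := {
  morph_rstar : {morph f : x / rstar x >-> rstar x};
  morph_rplus : {morph f : x / rplus x >-> rplus x}
}.

HB.structure Definition RMorphism (T S : BiunaryMagma.type) :=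
  {f of isMultiplicative T S f & isStarPlusMorphism T S f}.

Notation "{ 'restriction' T -> S }" := (RMorphism.type T S)
  (at level 0, T at level 98, S at level 99,
   format "{ 'restriction'  T  ->  S }") : type_scope.

Definition restriction_isomorphic (T S : restrictionType) : Prop :=
  exists f : {restriction T -> S}, bijective f.

HB.mixin Record Magma_isSemilattice Y of Magma Y := {
  slmulA : associative (@mul Y);
  slmulC : commutative (@mul Y);
  slmulxx : idempotent_op (@mul Y)
}.

#[short(type="semilatticeType")]
HB.structure Definition Semilattice := {Y of Magma_isSemilattice Y & Magma Y}.

Record proj (S : restrictionType) := Proj {
  proj_val :> S;
  projP : exists s : S, proj_val = rstar s
}.

Lemma proj_inj (S : restrictionType) : injective (@proj_val S).
Proof.
by case=> x px [y py] /= exy; subst y; congr Proj; exact: Prop_irrelevance.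
Qed.

Section RestrictionTheory.
Variable S : restrictionType.
Implicit Types (x y : S) (e f : proj S).

Lemma rplus_rplus x : rplus (rplus x) = rplus x.
Proof. by rewrite -{1}(rstar_plus x) rplus_star rstar_plus. Qed.

Lemma rstar_proj e : rstar (e : S) = e :> S.
Proof. by case: e => x /= [s ->]; rewrite -(rplus_star s) rstar_plus. Qed.

Lemma rplus_proj e : rplus (e : S) = e :> S.
Proof. by case: e => x /= [s ->]; rewrite rplus_star. Qed.

Lemma proj_mul_subproof e f : exists s : S, (e : S) * (f : S) = rstar s.
Proof. by exists ((e : S) * (f : S)); rewrite -{2}(rstar_proj f) rstar_mulr !rstar_proj. Qed.

Definition proj_mul e f : proj S := Proj (proj_mul_subproof e f).

Definition proj_star x : proj S := Proj (ex_intro _ x erefl).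

Lemma proj_plus_subproof x : exists s : S, rplus x = rstar s.
Proof. by exists (rplus x); rewrite rstar_plus. Qed.

Definition proj_plus x : proj S := Proj (proj_plus_subproof x).

Lemma proj_mulC_val e f : (e : S) * (f : S) = (f : S) * (e : S).
Proof. by rewrite -(rstar_proj e) -(rstar_proj f) rstarC. Qed.

Lemma proj_mulxx_val e : (e : S) * (e : S) = e :> S.
Proof. by rewrite -{2}(rstar_proj e) rstarK. Qed.

Lemma proj_mulA : associative proj_mul.
Proof. by move=> e f g; apply: proj_inj; rewrite /= rmulA. Qed.

Lemma proj_mulC : commutative proj_mul.
Proof. by move=> e f; apply: proj_inj; rewrite /= proj_mulC_val. Qed.

Lemma proj_mulxx : idempotent_op proj_mul.
Proof. by move=> e; apply: proj_inj; rewrite /= proj_mulxx_val. Qed.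

HB.instance Definition _ := hasMul.Build (proj S) proj_mul.
HB.instance Definition _ :=
  Magma_isSemilattice.Build (proj S) proj_mulA proj_mulC proj_mulxx.

Definition natle x y : Prop := exists e : proj S, x = (e : S) * y.

Definition compatible x y : Prop :=
  x * rstar y = y * rstar x /\ rplus y * x = rplus x * y.

Lemma natle_refl x : natle x x.
Proof. by exists (proj_plus x); rewrite /= rplusK. Qed.

Lemma natleP x y : natle x y -> x = rplus x * y.
Proof.
case=> e ->.
have -> : rplus ((e : S) * y) = (e : S) * rplus y.
  by rewrite -{1}(rplus_proj e) rplus_mull rplus_proj.
by rewrite -rmulA rplusK.
Qed.

Lemma natle_star x y : natle x y -> x = y * rstar x.
Proof.
by case=> e ->; rewrite rstar_ample rstar_proj.
Qed.

Lemma natle_trans : forall y x z, natle x y -> natle y z -> natle x z.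
Proof. by move=> y x z [e ->] [f ->]; exists (e * f); rewrite /= rmulA. Qed.

Lemma natle_proj e x : natle (e : S) (rstar x) -> rstar x * (e : S) = e :> S.
Proof.
case=> f fE; rewrite {1}fE.
by rewrite (proj_mulC_val f (proj_star x)) /= rmulA (proj_mulxx_val (proj_star x))
  (proj_mulC_val (proj_star x) f) -fE.
Qed.

Lemma rplus_mul_le x y : rplus x * rplus (x * y) = rplus (x * y).
Proof. by rewrite -rplus_mull rmulA rplusK. Qed.

Lemma rplus_mulrplus x y : rplus (x * rplus y) = rplus (x * y).
Proof. by rewrite -rplus_ample rplus_mull rplusC rplus_mul_le. Qed.

Lemma rstar_mulproj x e : rstar (x * (e : S)) = rstar x * (e : S).
Proof. by rewrite -{1}(rstar_proj e) rstar_mulr rstar_proj. Qed.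

Lemma natle_mulr x e : natle (x * (e : S)) x.
Proof.
by exists (proj_plus (x * (e : S))); rewrite /= rplus_ample rplus_proj.
Qed.

End RestrictionTheory.

Definition proper (T S : restrictionType) (psi : T -> S) : Prop :=
  (forall s, exists t, psi t = s) /\
  (forall u v, psi u = psi v -> compatible u v).

(* Partial bijections of X are represented by their graphs. *)

Record pbij (X : Type) := PBij {
  pgraph : X -> X -> Prop;
  pgraph_fun : forall x y y', pgraph x y -> pgraph x y' -> y = y';
  pgraph_inj : forall x x' y, pgraph x y -> pgraph x' y -> x = x'
}.

Definition pdom X (f : pbij X) (x : X) : Prop := exists y, pgraph f x y.
Definition pran X (f : pbij X) (y : X) : Prop := exists x, pgraph f x y.

Definition papp X (f : pbij X) (x : X) (fx : pdom f x) : X :=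
  projT1 (cid fx).
Definition pinv X (f : pbij X) (y : X) (fy : pran f y) : X :=
  projT1 (cid fy).

Lemma pappP X (f : pbij X) x (fx : pdom f x) : pgraph f x (papp fx).
Proof. exact: projT2 (cid fx). Qed.

Lemma pinvP X (f : pbij X) y (fy : pran f y) : pgraph f (pinv fy) y.
Proof. exact: projT2 (cid fy). Qed.

Section PartialActionProduct.
Variables (S : restrictionType) (Y : semilatticeType).
Variables (q : {multiplicative Y -> proj S}) (phi : S -> pbij Y).

Definition rtimes_set (ys : Y * S) : Prop :=
  pran (phi ys.2) ys.1 /\ (q ys.1 : S) = rplus ys.2.

(* The operations of the product are well defined. *)
Record rtimes_wf : Prop := RtimesWf {
  rtimes_dom : forall a b : Y * S, rtimes_set a -> rtimes_set b ->
    forall ra : pran (phi a.2) a.1, pdom (phi a.2) (pinv ra * b.1);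
  rtimes_closed_mul : forall a b : Y * S, rtimes_set a -> rtimes_set b ->
    forall (ra : pran (phi a.2) a.1) (dab : pdom (phi a.2) (pinv ra * b.1)),
    rtimes_set (papp dab, a.2 * b.2);
  rtimes_closed_star : forall a : Y * S, rtimes_set a ->
    forall ra : pran (phi a.2) a.1, rtimes_set (pinv ra, rstar a.2);
  rtimes_closed_plus : forall a : Y * S, rtimes_set a ->
    rtimes_set (a.1, rplus a.2)
}.

Definition rtimes (wf : rtimes_wf) : Type := {ys : Y * S | rtimes_set ys}.

Variable wf : rtimes_wf.
Implicit Types a b : rtimes wf.

Definition rtimes_val a : Y * S := proj1_sig a.

Definition rtimes_ran a : pran (phi (rtimes_val a).2) (rtimes_val a).1 :=
  proj1 (proj2_sig a).

Definition rtimes_mul a b : rtimes wf :=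
  exist rtimes_set _
    (rtimes_closed_mul wf (proj2_sig a) (proj2_sig b)
       (rtimes_dom wf (proj2_sig a) (proj2_sig b) (rtimes_ran a))).

Definition rtimes_star a : rtimes wf :=
  exist rtimes_set _ (rtimes_closed_star wf (proj2_sig a) (rtimes_ran a)).

Definition rtimes_plus a : rtimes wf :=
  exist rtimes_set _ (rtimes_closed_plus wf (proj2_sig a)).

HB.instance Definition _ := hasMul.Build (rtimes wf) rtimes_mul.
HB.instance Definition _ := hasStarPlus.Build (rtimes wf) rtimes_star rtimes_plus.

Lemma rtimes_val_inj : injective rtimes_val.
Proof.
by case=> x px [y py] /= exy; subst y; congr exist; exact: Prop_irrelevance.
Qed.

End PartialActionProduct.

Section Restrict.
Variables (T S : restrictionType) (psi : {restriction T -> S}).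

Lemma restrict_subproof (e : proj T) : exists s : S, psi (e : T) = rstar s.
Proof. by exists (psi (e : T)); rewrite -morph_rstar rstar_proj. Qed.

Definition restrict (e : proj T) : proj S := Proj (restrict_subproof e).

Lemma restrictM : {morph restrict : e f / e * f}.
Proof. by move=> e f; apply: proj_inj; rewrite /= gmulfM. Qed.

HB.instance Definition _ :=
  isMultiplicative.Build (proj T) (proj S) restrict restrictM.

End Restrict.

Section Underlying.
Variables (T S : restrictionType) (psi : {restriction T -> S}).
Hypothesis psi_proper : proper psi.

Definition upper_graph (s : S) (e f : proj T) : Prop :=
  exists t : T, [/\ natle (e : T) (rstar t), natle (psi t) s
                  & (f : T) = rplus (t * (e : T))].

Definition lower_graph (s : S) (e f : proj T) : Prop :=
  exists t : T, [/\ natle (e : T) (rstar t), psi t = s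
                  & (f : T) = rplus (t * (e : T))].

Lemma lower_upper s e f : lower_graph s e f -> upper_graph s e f.
Proof. by case=> t [le_e <- fE]; exists t; split=> //; exact: natle_refl. Qed.

Lemma proper_star_inj u v : psi u = psi v -> rstar u = rstar v -> u = v.
Proof.
move=> /(psi_proper.2 u v)[uv _] e; rewrite -(rstarK u) e uv e.
exact: rstarK.
Qed.

Lemma proper_plus_inj u v : psi u = psi v -> rplus u = rplus v -> u = v.
Proof.
move=> /(psi_proper.2 u v)[_ uv] e; rewrite -(rplusK u) e uv e.
exact: rplusK.
Qed.

Lemma natle_eq_star (R : restrictionType) (x y s : R) :
  natle x s -> natle y s -> rstar x = rstar y -> x = y.
Proof. by move=> /natle_star xE /natle_star yE e; rewrite xE e -yE. Qed.

Lemma natle_eq_plus (R : restrictionType) (x y s : R) :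
  natle x s -> natle y s -> rplus x = rplus y -> x = y.
Proof. by move=> /natleP xE /natleP yE e; rewrite xE e -yE. Qed.

Lemma upper_graphP s e f : upper_graph s e f ->
  exists u : T, [/\ natle (psi u) s, rstar u = e :> T & rplus u = f :> T].
Proof.
case=> t [le_e le_s fE]; exists (t * (e : T)); split=> //.
- apply: natle_trans le_s; rewrite gmulfM.
  exact: (natle_mulr (psi t) (restrict psi e)).
- by rewrite rstar_mulproj natle_proj.
Qed.

Lemma upper_fun s e f f' : upper_graph s e f -> upper_graph s e f' -> f = f'.
Proof.
move=> /upper_graphP[u [us ue uf]] /upper_graphP[v [vs ve vf]].
apply: proj_inj; rewrite -uf -vf; congr rplus; apply: proper_star_inj.
  by apply: natle_eq_star us vs _; rewrite -!morph_rstar ue ve.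
by rewrite ue ve.
Qed.

Lemma upper_inj s e e' f : upper_graph s e f -> upper_graph s e' f -> e = e'.
Proof.
move=> /upper_graphP[u [us ue uf]] /upper_graphP[v [vs ve vf]].
apply: proj_inj; rewrite -ue -ve; congr rstar; apply: proper_plus_inj.
  by apply: natle_eq_plus us vs _; rewrite -!morph_rplus uf vf.
by rewrite uf vf.
Qed.

Definition upper (s : S) : pbij (proj T) :=
  PBij (@upper_fun s) (@upper_inj s).

Definition lower (s : S) : pbij (proj T) :=
  PBij
    (fun e f f' h h' => upper_fun (@lower_upper s e f h) (lower_upper h'))
    (fun e e' f h h' => upper_inj (@lower_upper s e f h) (lower_upper h')).

End Underlying.

(* The well-definedness and the restriction semigroup identities are obtained
   simultaneously for the two underlying premorphisms. *)
Section UnderlyingProduct.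
Variables (T S : restrictionType) (psi : {restriction T -> S}).
Variable phi : S -> pbij (proj T).
Hypothesis phi_lower :
  forall s e f, lower_graph psi s e f -> pgraph (phi s) e f.
Hypothesis phi_upper :
  forall s e f, pgraph (phi s) e f -> upper_graph psi s e f.

Let q : {multiplicative proj T -> proj S} := restrict psi.

Lemma phi_graph u : pgraph (phi (psi u)) (proj_star u) (proj_plus u).
Proof.
apply: phi_lower; exists u; split=> //=; first exact: natle_refl.
by rewrite rstarK.
Qed.

Lemma phi_set u : rtimes_set q phi (proj_plus u, psi u).
Proof.
by split; [exists (proj_star u); exact: phi_graph | rewrite /= morph_rplus].
Qed.

Lemma phi_setP a : rtimes_set q phi a ->
  exists u, a = (proj_plus u, psi u).
Proof.
case: a => y s [/= [e /phi_upper/upper_graphP[u [us _ uf]]] qy].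
have yE : y = proj_plus u by apply: proj_inj.
exists u; rewrite yE; congr pair.
have := natleP us; rewrite -morph_rplus uf qy rplusK.
by move=> ->.
Qed.

Lemma phi_inv u (h : pran (phi (psi u)) (proj_plus u)) : pinv h = proj_star u.
Proof. exact: pgraph_inj (pinvP h) (phi_graph u). Qed.

Lemma phi_app u v (h : pdom (phi (psi u)) (proj_star u * proj_plus v)) :
  papp h = proj_plus (u * v).
Proof.
apply: pgraph_fun (pappP h) _; apply: phi_lower; exists u; split=> //=.
  exists (proj_plus v).
  exact: (proj_mulC_val (proj_star u) (proj_plus v)).
by rewrite rmulA rstarK rplus_mulrplus.
Qed.

Lemma phi_wf : rtimes_wf q phi.
Proof.
split.
- move=> a b /phi_setP[u ->] /phi_setP[v ->] /= ra; rewrite phi_inv.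
  exists (proj_plus (u * v)); apply: phi_lower; exists u; split=> //=.
    exists (proj_plus v).
    exact: (proj_mulC_val (proj_star u) (proj_plus v)).
  by rewrite rmulA rstarK rplus_mulrplus.
- move=> a b /phi_setP[u ->] /phi_setP[v ->] /= ra; rewrite phi_inv => dab.
  by rewrite phi_app -gmulfM; exact: phi_set.
- move=> a /phi_setP[u ->] /= ra; rewrite phi_inv -morph_rstar.
  have -> : proj_star u = proj_plus (rstar u).
    by apply: proj_inj; rewrite /= rplus_star.
  exact: phi_set.
- move=> a /phi_setP[u ->] /=; rewrite -morph_rplus.
  have -> : proj_plus u = proj_plus (rplus u).
    by apply: proj_inj; rewrite /= rplus_rplus.
  exact: phi_set.
Qed.

Variable wf : rtimes_wf q phi.

Definition phi_elt (u : T) : rtimes wf :=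
  exist (rtimes_set q phi) _ (phi_set u).

Lemma phi_eltP (a : rtimes wf) : exists u, a = phi_elt u.
Proof.
have [u uE] := phi_setP (proj2_sig a).
by exists u; apply: rtimes_val_inj.
Qed.

Lemma phi_eltM u v : phi_elt u * phi_elt v = phi_elt (u * v).
Proof.
apply: rtimes_val_inj; rewrite /rtimes_val /= -gmulfM; congr pair.
move: (rtimes_dom _ _ _ _); rewrite /= phi_inv => h; exact: phi_app.
Qed.

Lemma phi_elt_star u : rstar (phi_elt u) = phi_elt (rstar u).
Proof.
apply: rtimes_val_inj; rewrite /rtimes_val /= -morph_rstar phi_inv.
by congr pair; apply: proj_inj; rewrite /= rplus_star.
Qed.

Lemma phi_elt_plus u : rplus (phi_elt u) = phi_elt (rplus u).
Proof.
apply: rtimes_val_inj; rewrite /rtimes_val /= -morph_rplus.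
by congr pair; apply: proj_inj; rewrite /= rplus_rplus.
Qed.

Definition phi_eltE := (phi_eltM, phi_elt_star, phi_elt_plus).

Lemma phi_restriction : BiunaryMagma_isRestriction (rtimes wf).
Proof.
split.
- move=> a b c; have [u ->] := phi_eltP a; have [v ->] := phi_eltP b.
  by have [w ->] := phi_eltP c; rewrite !phi_eltE rmulA.
- by move=> a; have [u ->] := phi_eltP a; rewrite !phi_eltE rplusK.
- move=> a b; have [u ->] := phi_eltP a; have [v ->] := phi_eltP b.
  by rewrite !phi_eltE rplusC.
- move=> a b; have [u ->] := phi_eltP a; have [v ->] := phi_eltP b.
  by rewrite !phi_eltE rplus_mull.
- move=> a b; have [u ->] := phi_eltP a; have [v ->] := phi_eltP b.
  by rewrite !phi_eltE rplus_ample.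
- by move=> a; have [u ->] := phi_eltP a; rewrite !phi_eltE rstarK.
- move=> a b; have [u ->] := phi_eltP a; have [v ->] := phi_eltP b.
  by rewrite !phi_eltE rstarC.
- move=> a b; have [u ->] := phi_eltP a; have [v ->] := phi_eltP b.
  by rewrite !phi_eltE rstar_mulr.
- move=> a b; have [u ->] := phi_eltP a; have [v ->] := phi_eltP b.
  by rewrite !phi_eltE rstar_ample.
- by move=> a; have [u ->] := phi_eltP a; rewrite !phi_eltE rstar_plus.
- by move=> a; have [u ->] := phi_eltP a; rewrite !phi_eltE rplus_star.
Qed.

End UnderlyingProduct.

Section Products.
Variables (T S : restrictionType) (psi : {restriction T -> S}).
Variable psi_proper : proper psi.

Lemma upper_wf : rtimes_wf (restrict psi) (upper psi_proper).
Proof. by apply: phi_wf => // s e f; exact: lower_upper. Qed.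

Lemma lower_wf : rtimes_wf (restrict psi) (lower psi_proper).
Proof. by apply: phi_wf => // s e f; exact: lower_upper. Qed.

Definition upper_product : Type := rtimes upper_wf.
Definition lower_product : Type := rtimes lower_wf.

Lemma upper_restriction : BiunaryMagma_isRestriction (rtimes upper_wf).
Proof. by apply: phi_restriction => // s e f; exact: lower_upper. Qed.

Lemma lower_restriction : BiunaryMagma_isRestriction (rtimes lower_wf).
Proof. by apply: phi_restriction => // s e f; exact: lower_upper. Qed.

HB.instance Definition _ := BiunaryMagma.on upper_product.
HB.instance Definition _ : BiunaryMagma_isRestriction upper_product :=
  upper_restriction.

HB.instance Definition _ := BiunaryMagma.on lower_product.
HB.instance Definition _ : BiunaryMagma_isRestriction lower_product :=
  lower_restriction.

(* The inclusions of both products into P(T) x S. *)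
Definition upper_incl : upper_product -> proj T * S := @rtimes_val _ _ _ _ _.
Definition lower_incl : lower_product -> proj T * S := @rtimes_val _ _ _ _ _.

End Products.

(* Equality of restriction semigroups carried by subsets of one ambient set:
   [i] and [j] are the inclusions of A and B into U. *)
Definition same_restriction (U : Type) (A B : restrictionType)
    (i : A -> U) (j : B -> U) : Prop :=
  (forall u : U, (exists a, i a = u) <-> (exists b, j b = u)) /\
  (forall (a a' : A) (b b' : B), i a = j b -> i a' = j b' ->
    [/\ i (a * a') = j (b * b'), i (rstar a) = j (rstar b)
      & i (rplus a) = j (rplus b)]).

(* Main.v *)
From HB Require Import structures.
From mathcomp Require Import all_boot.
From mathcomp Require Import boolp.
Import monoid.
Require Import Defs.

(** The isomorphism sends u in T to the pair (u^+, psi u).  It is injective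
    because psi is proper: two elements with the same image under psi and the
    same projection u^+ coincide ([proper_plus_inj]).  It is surjective for
    the upper premorphism as well as for the lower one ([phi_eltP]): if y is
    in the range of the upper map at s, then y = u^+ for some u with
    psi u <= s, and the condition p y = s^+ leaves psi u no room below s,
    since psi u = (psi u)^+ s = s^+ s = s.

    The same map thus parametrizes both products, as subsets of P(T) x S, by
    the elements of T, and in both cases it carries the operations of T to
    those of the product ([phi_eltE]).  The two products are therefore images
    of T under one and the same map into P(T) x S, so they have the same
    elements and the same operations. *)

Set Implicit Arguments.
Unset Strict Implicit.
Unset Printing Implicit Defensive.

Local Open Scope group_scope.

Lemma bij_of_inj_surj (A B : Type) (f : A -> B) :
  injective f -> (forall b, exists a, b = f a) -> bijective f.
Proof.
move=> f_inj f_surj; pose g b := projT1 (cid (f_surj b)).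
have gK b : f (g b) = b by rewrite /g; case: cid.
by exists g => // a; apply: f_inj.
Qed.

Section Parametrization.
Variables (T S : restrictionType) (psi : {restriction T -> S}).
Hypothesis psi_proper : proper psi.

(** The two products are distinct types, so the map u |-> (u^+, psi u) is
    needed once into each of them. *)
Definition upper_elt : T -> upper_product psi_proper :=
  phi_elt (phi := upper psi_proper) (@lower_upper _ _ psi)
    (upper_wf psi_proper).

Definition lower_elt : T -> lower_product psi_proper :=
  phi_elt (phi := lower psi_proper) (fun s e f h => h) (lower_wf psi_proper).

Lemma upper_eltM : {morph upper_elt : u v / u * v}.
Proof. by move=> u v; rewrite /upper_elt -phi_eltM. Qed.

Lemma upper_elt_star : {morph upper_elt : u / rstar u}.
Proof. by move=> u; rewrite /upper_elt -phi_elt_star. Qed.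

Lemma upper_elt_plus : {morph upper_elt : u / rplus u}.
Proof. by move=> u; rewrite /upper_elt -phi_elt_plus. Qed.

Lemma lower_eltM : {morph lower_elt : u v / u * v}.
Proof. by move=> u v; rewrite /lower_elt -phi_eltM. Qed.

Lemma lower_elt_star : {morph lower_elt : u / rstar u}.
Proof. by move=> u; rewrite /lower_elt -phi_elt_star. Qed.

Lemma lower_elt_plus : {morph lower_elt : u / rplus u}.
Proof. by move=> u; rewrite /lower_elt -phi_elt_plus. Qed.

Lemma upper_elt_surj a : exists u, a = upper_elt u.
Proof. by apply: phi_eltP. Qed.

Lemma lower_elt_surj b : exists u, b = lower_elt u.
Proof. by apply: phi_eltP => s e f; exact: lower_upper. Qed.

Lemma upper_inclE u : upper_incl (upper_elt u) = (proj_plus u, psi u).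
Proof. by []. Qed.

Lemma lower_inclE u : lower_incl (lower_elt u) = (proj_plus u, psi u).
Proof. by []. Qed.

(** The only use of properness beyond the existence of the products:
    elements of T in one fibre of psi are compatible, and compatible elements
    u, v with u^+ = v^+ are equal, since then u = v^+ u = u^+ v = v. *)
Lemma pair_inj : injective (fun u : T => (proj_plus u, psi u)).
Proof. by move=> u v [uv psi_uv]; exact: proper_plus_inj psi_uv uv. Qed.

Lemma upper_elt_inj : injective upper_elt.
Proof.
by move=> u v uv; apply: pair_inj; rewrite -!upper_inclE uv.
Qed.

HB.instance Definition _ := isMultiplicative.Build _ _ upper_elt upper_eltM.
HB.instance Definition _ :=
  isStarPlusMorphism.Build _ _ upper_elt upper_elt_star upper_elt_plus.

End Parametrization.

Theorem theorem4p13 (T S : restrictionType) (psi : {restriction T -> S})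
    (psi_proper : proper psi) :
  restriction_isomorphic T (upper_product psi_proper) /\
  same_restriction (@upper_incl T S psi psi_proper)
    (@lower_incl T S psi psi_proper).
Proof.
split.
  exists (upper_elt psi_proper : {restriction _ -> _}).
  apply: bij_of_inj_surj; [exact: upper_elt_inj | exact: upper_elt_surj].
split.
  move=> u; split=> [[a <-] | [b <-]].
    by have [t ->] := upper_elt_surj a; exists (lower_elt psi_proper t).
  by have [t ->] := lower_elt_surj b; exists (upper_elt psi_proper t).
move=> a a' b b'; have [t ->] := upper_elt_surj a.
have [t' ->] := upper_elt_surj a'; have [v ->] := lower_elt_surj b.
have [v' ->] := lower_elt_surj b'.
(* The inclusions see the same pair only for the same parameter in T, so the
   operations on either side are all computed in T. *)
rewrite !upper_inclE !lower_inclE => /(pair_inj psi_proper) <-.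
move=> /(pair_inj psi_proper) <-.
by rewrite -upper_eltM -upper_elt_star -upper_elt_plus
  -lower_eltM -lower_elt_star -lower_elt_plus.
Qed.
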